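(* Let $G$ be a group with identity element $e$ and let $R$ be an $s$-unital strongly $G$-graded ring. If $f$ is a nonzero central idempotent in $R$, then $f$ has finite support group. In particular, if $G$ is torsion-free, then every central idempotent in $R$ is contained in $R_e$.
   Context: Rings are associative but not necessarily unital and not necessarily commutative. A ring $R$ is $G$-graded if there is a collection of additive subgroups $\{R_g\}_{g\in G}$ of $R$ such that $R=\bigoplus_{g\in G} R_g$ and $R_gR_h\subseteq R_{gh}$ for all $g,h\in G$; it is strongly $G$-graded if $R_gR_h=R_{gh}$ for all $g,h\in G$, where $R_gR_h$ denotes the set of finite sums of products $xy$ with $x\in R_g$, $y\in R_h$. A ring $R$ is $s$-unital if $r\in rR\cap Rr$ for every $r\in R$. The support of a nonzero element $r=\sum_{g\in G} r_g$ (with $r_g\in R_g$) is the finite set $\operatorname{Supp}(r)=\{g\in G\mid r_g\neq 0\}$. The support group of $r$ is the subgroup of $G$ generated by $\operatorname{Supp}(r)$. *)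

(* Defs.v *)
From HB Require Import structures.
From mathcomp Require Import all_boot all_order all_algebra.
From mathcomp Require Import boolp classical_sets functions cardinality fsbigop.

Set Implicit Arguments.
Unset Strict Implicit.
Unset Printing Implicit Defensive.

Import GRing.Theory.

Local Open Scope classical_set_scope.
Local Open Scope ring_scope.
Local Open Scope group_scope.

(* Associative rings, not necessarily unital or commutative. The product is the
   semigroup law [x * y] of [group_scope], since [GRing.mul] requires a unit. *)
HB.mixin Record Zmodule_Semigroup_isRng R
    of GRing.Zmodule R & Semigroup R := {
  rng_mulDl : left_distributive (@monoid.mul R) +%R;
  rng_mulDr : right_distributive (@monoid.mul R) +%R
}.

#[short(type="rngType")]
HB.structure Definition Rng :=
  {R of Zmodule_Semigroup_isRng R & GRing.Zmodule R & Semigroup R}.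

Definition s_unital (R : rngType) : Prop :=
  forall r : R, (exists u, r = r * u) /\ (exists v, r = v * r).

Definition central_idempotent (R : rngType) (f : R) : Prop :=
  f * f = f /\ forall r : R, f * r = r * f.

Definition torsion_free (G : groupType) : Prop :=
  forall (g : G) (n : nat), (0 < n)%N -> g ^+ n = 1 -> g = 1.

Definition additive_subgroup (V : zmodType) (A : set V) : Prop :=
  A 0%R /\ forall x y, A x -> A y -> A (x - y)%R.

Definition subgroup (G : groupType) (H : set G) : Prop :=
  H 1 /\ forall x y, H x -> H y -> H (x / y).

Definition subgroup_generated (G : groupType) (S : set G) : set G :=
  smallest (@subgroup G) S.

Definition prod_set (R : rngType) (A B : set R) : set R :=
  [set z | exists2 s : seq (R * R),
     (forall p, p \in s -> A p.1 /\ B p.2) & z = (\sum_(p <- s) (p.1 * p.2)%g)%R].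

Section Graded.
Variables (G : groupType) (R : rngType) (R_ : G -> set R).

(* Finiteness of the support is explicit because [\sum_(g \in _) _] is 0 on
   families of infinite support. *)
Definition decomposition (r : R) : set (G -> R) :=
  [set c | [/\ forall g, R_ g (c g),
               finite_set [set g | c g != 0%R]
             & r = (\sum_(g \in [set: G]) c g)%R]].

Definition direct_sum : Prop := forall r, exists! c, decomposition r c.

Definition graded : Prop :=
  [/\ forall g, additive_subgroup (R_ g),
      direct_sum
    & forall g h x y, R_ g x -> R_ h y -> R_ (g * h) (x * y)].

Definition strongly_graded : Prop :=
  graded /\ forall g h, prod_set (R_ g) (R_ h) = R_ (g * h).

(* [component r g] is r_g; the default value is irrelevant in a graded ring. *)
Definition component (r : R) : G -> R :=
  xget (fun=> 0%R) (decomposition r).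

Definition supp (r : R) : set G := [set g | component r g != 0%R].

Definition support_group (r : R) : set G := subgroup_generated (supp r).

Lemma componentP (r : R) : graded -> decomposition r (component r).
Proof.
by case=> _ /(_ r) [c [cP _]] _; rewrite /component; case: xgetP => // /(_ c).
Qed.

End Graded.

(* Main.v *)
Require Import Defs.
From HB Require Import structures.
From mathcomp Require Import all_boot all_order all_algebra.
From mathcomp Require Import boolp classical_sets functions cardinality fsbigop.

(** The support S of a central idempotent f is finite. It is also closed under
    conjugation by G: for r in R_g, comparing components in f r = r f gives
    f_h r = r f_(h^g), so f_(h^g) = 0 forces f_h R_g = 0, hence f_h R_e = 0
    because R_e = R_g R_(g^-1), hence f_h = 0 by s-unitality ([support_conj]).

    Everything then rests on the claim that each g in S has finite order
    ([support_torsion]). Given the claim, a finite conjugation-closed set of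
    torsion elements generates a finite group (Dietzmann's lemma,
    [finite_subgroup_generated]); and if G is torsion-free, S is contained in
    the trivial subgroup, so f lies in R_e.

    The claim combines a group-theoretic and a ring-theoretic fact.

    Group theory ([partial_degree]). If g in S has infinite order, there is an
    integer-valued degree c that is additive on products of elements of S and
    has c g > 0. Take m such that m-th powers of elements of S commute with S.
    Conjugation by S does not change these powers, so gathering equal letters
    of a word w in S turns its product into a product of such powers times a
    short word ([collect]). Consequently, (prod w)^m and the product of the
    m-th powers of the letters of w differ by one of finitely many elements of
    G, whatever w is. Two words with the same product whose letter counts
    differ by n copies of g therefore force g to be torsion
    ([relation_torsion]); so when g has infinite order, its count vector is
    outside the rational span of all relations among words, and some linear
    functional separates it from that span ([separating_functional]).

    Ring theory ([central_idempotent_degree]). No component of f has positive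
    degree. After a shift by K the degrees d of elements of S are natural
    numbers. The elements p_n = sum_h C(d h, n) f_h are the Hasse derivatives
    at t = 1 of the polynomial P(t) = sum_h f_h t^(d h), and f f = f reads
    P^2 = t^K P. Since f is a central idempotent, this recursion has the unique
    solution p_n = C(K, n) f ([idempotent_binomials]). If d g > K, the
    g-component of this equality at n = d g is f_g = 0. *)

Set Implicit Arguments.
Unset Strict Implicit.
Unset Printing Implicit Defensive.

Import Order.TTheory GRing.Theory Num.Theory.

Local Open Scope classical_set_scope.
Local Open Scope ring_scope.
Local Open Scope group_scope.

(** * Separation of a vector from a subspace *)

(** L is the row space of a matrix M of maximal rank among those whose rows
    span a part of L, and a column of the cokernel of M gives the functional.
    L is a Prop-valued predicate because membership in the space of relations
    between words need not be decidable. *)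
Lemma separating_functional (F : fieldType) (k : nat) (L : 'rV[F]_k -> Prop)
    (u : 'rV[F]_k) :
    L 0%R -> (forall x y, L x -> L y -> L (x + y)%R) ->
    (forall a x, L x -> L (a *: x)%R) -> ~ L u ->
  exists2 c : 'cV[F]_k, (forall x, L x -> x *m c = 0)%R & (u *m c != 0)%R.
Proof.
move=> L0 LD LZ Lu.
pose spanned r :=
  `[< exists2 M : 'M[F]_k, (forall x, (x <= M)%MS -> L x) & \rank M = r >].
have ex : exists r, spanned r.
  exists 0%N; apply/asboolP; exists 0%R; last exact: mxrank0.
  by move=> x; rewrite submx0 => /eqP->.
have bound r : spanned r -> (r <= k)%N by move=> /asboolP[M _ <-]; exact: rank_leq_row.
case: (ex_maxnP ex bound) => r /asboolP[M ML rM] rmax.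
have LM x : L x -> (x <= M)%MS.
  move=> Lx; have/(rmax _) : spanned (\rank (M + x)%MS).
    apply/asboolP; exists (M + x)%MS => // y /sub_addsmxP[[a b] ->].
    apply: LD; first by apply: ML; apply: submxMl.
    by rewrite (mx11_scalar b) mul_scalar_mx; apply: LZ.
  rewrite -rM => le; have : (M == M + x)%MS.
    by rewrite -(mxrank_leqif_eq (addsmxSl M x)) eqn_leq le mxrankS // addsmxSl.
  by case/andP => _; apply: submx_trans; apply: addsmxSr.
have : (u *m cokermx M != 0)%R.
  by apply: contra_notN Lu => uM; apply: ML; rewrite submxE.
case/rV0Pn => l ul; exists (col l (cokermx M)) => [x /LM|].
  by rewrite submxE colE mulmxA => /eqP->; rewrite mul0mx.
by rewrite colE mulmxA -colE; apply: contra_neq ul => /colP/(_ 0%R); rewrite !mxE.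
Qed.

(** * Words in a finite conjugation-closed set *)

Lemma pigeonhole (T : eqType) (s : seq T) (f : nat -> T) :
  (forall i, f i \in s) -> exists i j, (i < j)%N /\ f i = f j.
Proof.
move=> fs; have [/uniq_leq_size us|] := boolP (uniq (map f (iota 0 (size s).+1))).
  suff : ((size s).+1 <= size s)%N by rewrite ltnn.
  by rewrite -{1}(size_iota 0 (size s).+1) -(size_map f) us // => _ /mapP[i _ ->].
case/(uniqPn (f 0%N)) => i [j []]; rewrite size_map size_iota => ij js.
rewrite !(nth_map 0%N) ?size_iota ?(ltn_trans ij) // !nth_iota ?(ltn_trans ij) //.
by rewrite !add0n => e; exists i, j.
Qed.

Lemma common_multiple (T : eqType) (s : seq T) (P : T -> nat -> Prop) :
    (forall x m n, P x m -> P x (m * n)%N) ->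
    (forall x, x \in s -> exists2 m, (0 < m)%N & P x m) ->
  exists2 m, (0 < m)%N & forall x, x \in s -> P x m.
Proof.
move=> PM; elim: s => [|y s IH] Ps; first by exists 1%N.
have [x xs|m m0 mP] := IH; first by apply: Ps; rewrite inE xs orbT.
have [n n0 nP] := Ps y (mem_head _ _).
exists (m * n)%N => [|x]; first by rewrite muln_gt0 m0.
by rewrite inE => /predU1P[->|/mP/PM//]; rewrite mulnC; apply: PM.
Qed.

Section Words.
Variables (G : groupType) (S : seq G).
Implicit Types (w v : seq G) (s t z : G).

Definition word w := {subset w <= S}.
Definition central_exponent m := {in S &, forall s t, commute (s ^+ m) t}.
Hypothesis Sconj : {in S &, forall s t, s ^ t \in S}.

Lemma word_cons s w : word (s :: w) <-> s \in S /\ word w.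
Proof.
split=> [sw|[sS sw] t].
  by split=> [|t tw]; apply: sw; rewrite inE ?eqxx ?tw ?orbT.
by rewrite inE => /predU1P[->//|/sw].
Qed.

Lemma word_cat w v : word (w ++ v) <-> word w /\ word v.
Proof.
split=> [sw|[sw sv] t]; last by rewrite mem_cat => /orP[/sw|/sv].
by split=> t tw; apply: sw; rewrite mem_cat tw ?orbT.
Qed.

Definition iter_word k w : seq G := flatten (nseq k w).

Lemma word_iter k w : word w -> word (iter_word k w).
Proof. by move=> wS; elim: k => //= k IH; apply/word_cat. Qed.

Lemma prod_iter_word k w : \prod_(s <- iter_word k w) s = (\prod_(s <- w) s) ^+ k.
Proof. by elim: k => [|k IH]; rewrite ?big_nil //= big_cat IH /= expgS. Qed.

Lemma word_nseq n s : s \in S -> word (nseq n s).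
Proof. by move=> sS t /nseqP[->]. Qed.

Lemma commute_word z w : {in S, forall t, commute z t} -> word w ->
  commute z (\prod_(s <- w) s).
Proof.
move=> zS sw; rewrite big_seq; apply: commute_prod => t /sw; exact: zS.
Qed.

(** Iterated conjugation by s moves t inside the finite set S, hence it
    returns to t after finitely many steps. *)
Lemma central_exponent_exists : exists2 m, (0 < m)%N & central_exponent m.
Proof.
have [|s sS|m m0 mP] :=
    @common_multiple _ S (fun s m => {in S, forall t, commute (s ^+ m) t}).
- by move=> s m n sm t /sm/commute_sym/(commuteX n)/commute_sym; rewrite expgnA.
- apply: (@common_multiple _ S (fun t m => commute (s ^+ m) t)).
    by move=> t m n /commute_sym/(commuteX n)/commute_sym; rewrite expgnA.
  move=> t tS; have [|i [j [ij e]]] := @pigeonhole _ S (fun i => t ^ (s ^+ i)).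
    by elim=> [|i IH]; rewrite ?conjg1 // expgSr conjgM Sconj.
  exists (j - i)%N; first by rewrite subn_gt0.
  apply: commute_sym; apply/commgP/conjg_fixP/(conjg_inj (s ^+ i)).
  by rewrite /= -conjgM -expgnDr subnK // ltnW.
- by exists m => // s t /mP; apply.
Qed.

Section Collecting.
Variable m : nat.
Hypothesis m_central : central_exponent m.

Definition central_prod w := \prod_(s <- w) s ^+ m.

Lemma central_prod_cons s w : central_prod (s :: w) = s ^+ m * central_prod w.
Proof. exact: big_cons. Qed.

Lemma central_prod_cat w v : central_prod (w ++ v) = central_prod w * central_prod v.
Proof. exact: big_cat. Qed.

(** This is what makes [central_prod] insensitive to the conjugations caused
    by moving letters past each other. *)
Lemma conj_power s t : s \in S -> t \in S -> (s ^ t) ^+ m = s ^+ m.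
Proof. by move=> sS tS; rewrite -conjXg; apply/conjg_fixP/commgP/m_central. Qed.

(** Moving s to the front of w conjugates by s the letters it jumps over; those
    equal to s are unchanged, so no other occurrence of s is lost. *)
Lemma pull_letter s w : s \in w -> word w ->
  exists v, [/\ word v, (size v).+1 = size w,
    ((count_mem s w) <= (count_mem s v).+1)%N,
    \prod_(t <- w) t = s * \prod_(t <- v) t & central_prod w = s ^+ m * central_prod v].
Proof.
move=> sw wS; have sS := wS _ sw; case/splitPr: sw wS => w1 w2.
case/word_cat => w1S /word_cons[_ w2S].
exists ([seq t ^ s | t <- w1] ++ w2); split.
- by apply/word_cat; split=> // _ /mapP[t /w1S tS ->]; apply: Sconj.
- by rewrite !size_cat size_map addnS.
- rewrite !count_cat count_map /= eqxx addnCA add1n ltnS leq_add2r.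
  by apply: sub_count => t /= /eqP->; rewrite /conjg mulKg.
- by rewrite !big_cat big_cons big_map /= -conjg_prod !mulgA mulgV mul1g.
- rewrite !central_prod_cat central_prod_cons !mulgA; congr (_ * _).
  have -> : central_prod [seq t ^ s | t <- w1] = central_prod w1.
    rewrite /central_prod big_map big_seq [RHS]big_seq; apply: eq_bigr => t /w1S tS.
    exact: conj_power.
  have /(commute_word (z := s ^+ m)) : {in S, forall t, commute (s ^+ m) t}.
    by move=> t; apply: m_central.
  move=> cs; rewrite /central_prod big_seq; apply/commute_sym/commute_prod => t /w1S tS.
  exact/commuteX/m_central.
Qed.

Lemma pull_power k s w : s \in S -> (k <= count_mem s w)%N -> word w ->
  exists v, [/\ word v, (size v + k)%N = size w,
    \prod_(t <- w) t = s ^+ k * \prod_(t <- v) t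
    & central_prod w = (s ^+ m) ^+ k * central_prod v].
Proof.
move=> sS; elim: k w => [|k IH] w kw wS.
  by exists w; rewrite addn0 !mul1g.
have sw : s \in w by rewrite -has_pred1 has_count (leq_trans _ kw).
have [v [vS vw cv pv zv]] := pull_letter sw wS.
have [|u [uS uv pu zu]] := IH v _ vS; first by rewrite -ltnS (leq_trans kw).
exists u; split=> //; first by rewrite addnS uv.
  by rewrite pv pu mulgA expgS.
by rewrite zv zu mulgA expgS.
Qed.

Lemma frequent_letter w : word w -> (m * size S < size w)%N ->
  exists2 s, s \in S & (m <= count_mem s w)%N.
Proof.
move=> wS; apply: contraTP => nex; rewrite -leqNgt.
have cm s : s \in S -> (count_mem s w <= m)%N.
  move=> sS; rewrite leqNgt; apply/negP => /ltnW ?; apply: nex; by exists s.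
have -> : size w = (\sum_(s <- undup w) count_mem s w)%N.
  rewrite -sum1_size -big_undup_iterop_count; apply: eq_bigr => s _.
  by rewrite Monoid.iteropE iter_addn_0 mul1n.
apply: (@leq_trans (\sum_(s <- undup w) m)%N).
  by rewrite !big_seq; apply: leq_sum => s; rewrite mem_undup => /wS/cm.
rewrite big_const_seq count_predT iter_addn_0 leq_mul2l.
rewrite uniq_leq_size ?orbT ?undup_uniq //.
by move=> s; rewrite mem_undup => /wS.
Qed.

Lemma commute_central_prod w t : word w -> t \in S -> commute (central_prod w) t.
Proof.
move=> wS tS; rewrite /central_prod big_seq.
apply/commute_sym/commute_prod => s /wS sS; exact/commute_sym/m_central.
Qed.

Lemma commute_central_prods w v : word w -> word v ->
  commute (central_prod w) (central_prod v).
Proof.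
move=> wS vS; rewrite [X in commute _ X]/central_prod big_seq.
by apply: commute_prod => s /vS sS; apply/commuteX/commute_central_prod.
Qed.

Lemma central_prod_perm w v : perm_eq w v -> word w -> central_prod w = central_prod v.
Proof.
elim: w v => [|s w IH] v pv; first by move: pv; rewrite perm_sym => /perm_nilP->.
case/word_cons => sS wS; have sv: s \in v by rewrite -(perm_mem pv) mem_head.
case/splitPr: sv pv => v1 v2.
rewrite perm_sym perm_catC perm_cons perm_catC perm_sym => pv.
rewrite central_prod_cons (IH _ pv) // !central_prod_cat central_prod_cons.
have v1S : word v1 by move=> t tv; apply: wS; rewrite (perm_mem pv) mem_cat tv.
by rewrite !mulgA (commuteX m (commute_central_prod v1S sS)).
Qed.

(** A word longer than m * size S has a letter s occurring m times; these
    occurrences are gathered into the power s ^+ m, and one recurses on the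
    shorter rest. Since s ^+ m commutes with S, raising the product of w to the
    m-th power affects the gathered part exactly as [central_prod] does. *)
Lemma collect w : (0 < m)%N -> word w ->
  exists u v, [/\ word u, word v, (size v <= m * size S)%N,
     \prod_(t <- w) t = central_prod u * \prod_(t <- v) t
     & central_prod w = central_prod u ^+ m * central_prod v].
Proof.
move=> m0; have [n] := ubnP (size w); elim: n w => // n IH w wn wS.
have [ws|ws] := leqP (size w) (m * size S).
  by exists [::], w; rewrite /central_prod big_nil expg1n !mul1g.
have [s sS sw] := frequent_letter wS ws.
have [v [vS vw pv zv]] := pull_power sS sw wS.
have [|u [y [uS yS ys py zy]]] := IH v _ vS.
  by rewrite -ltnS (leq_trans _ wn) // ltnS -vw -addn1 leq_add2l.
exists (s :: u), y; rewrite central_prod_cons; split=> //; first exact/word_cons.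
  by rewrite pv py mulgA.
rewrite zv zy mulgA expgMn //; apply/commute_sym/commuteX.
exact: commute_central_prod.
Qed.

End Collecting.

Fixpoint words_upto n : seq (seq G) :=
  if n is n'.+1 then [::] :: [seq s :: w | s <- S, w <- words_upto n']
  else [:: [::]].

Lemma mem_words_upto n w : word w -> (size w <= n)%N -> w \in words_upto n.
Proof.
elim: n w => [|n IH] [|s w] //= /word_cons[sS wS] wn.
by rewrite inE; apply/orP; right; apply/allpairsP; exists (s, w); rewrite sS IH.
Qed.

(** Dietzmann's lemma. With m a common exponent of S, [collect] gathers only
    trivial powers, so every product of letters is a product of a short word;
    inverses are products of letters because S is torsion. *)
Lemma finite_subgroup_generated :
    (forall s, s \in S -> exists2 n, (0 < n)%N & s ^+ n = 1) ->
  finite_set (subgroup_generated [set` S]).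
Proof.
move=> torS; have [|m m0 mS] := @common_multiple _ S (fun s n => s ^+ n = 1) _ torS.
  by move=> s p q; rewrite expgnA => ->; rewrite expg1n.
have m_central : central_exponent m.
  by move=> s t sS _; rewrite mS //; apply/commute_sym/commute1.
pose H := [set x | exists2 w, word w & x = \prod_(s <- w) s].
have HM x y : H x -> H y -> H (x * y).
  move=> [w wS ->] [v vS ->]; exists (w ++ v); last by rewrite big_cat.
  exact/word_cat.
have HV x : H x -> H x^-1.
  case=> w wS ->; elim: w wS => [|s w IH].
    by rewrite big_nil invg1; exists [::]; rewrite ?big_nil.
  case/word_cons => sS wS; rewrite big_cons invgM; apply: HM (IH wS) _.
  exists (nseq m.-1 s); first exact: word_nseq.
  apply: mulg1_eq; rewrite big_nseq -[RHS](mS s sS) -(prednK m0) expgS /=.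
  by congr (_ * _); elim: m.-1 => //= k ->; rewrite expgS.
have sub : subgroup_generated [set` S] `<=` H.
  apply: smallest_sub; last first.
    by move=> s sS; exists [:: s]; rewrite ?big_seq1 //; apply/word_cons.
  split=> [|x y Hx /HV]; last exact: HM.
  by exists [::]; rewrite ?big_nil.
apply: (sub_finite_set sub).
apply: (@sub_finite_set _ _
  [set` [seq \prod_(s <- v) s | v <- words_upto (m * size S)]]); last exact: finite_seq.
move=> _ [w wS ->] /=; have [u [v [uS vS vs -> _]]] := collect m_central m0 wS.
rewrite /central_prod big_seq big1 ?mul1g => [|s /uS/mS //].
by apply: map_f; apply: mem_words_upto.
Qed.

(** The quotient [delta u] of (prod u)^m by [central_prod m u] takes finitely
    many values. Comparing it on the k-th iterates of w and v, which have the
    same product, shows that g ^+ (m * n * k) lies in a fixed finite set for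
    all k. *)
Lemma relation_torsion w v g n : word w -> word v -> g \in S -> (0 < n)%N ->
    \prod_(s <- w) s = \prod_(s <- v) s -> perm_eq w (nseq n g ++ v) ->
  exists2 k, (0 < k)%N & g ^+ k = 1.
Proof.
move=> wS vS gS n0 pwv permwv; have [m m0 m_central] := central_exponent_exists.
have central_prod_iter k u : central_prod m (iter_word k u) = central_prod m u ^+ k.
  elim: k => [|k IH]; first by rewrite /central_prod big_nil.
  by rewrite expgS -IH -central_prod_cat.
pose delta u := (\prod_(s <- u) s) ^+ m * (central_prod m u)^-1.
pose F := [seq delta u | u <- words_upto (m * size S)].
have delta_F u : word u -> delta u \in F.
  move=> uS; have [x [y [xS yS ys py zy]]] := collect m_central m0 uS.
  suff -> : delta u = delta y by apply/map_f/mem_words_upto.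
  have cxy : commute (central_prod m x) (\prod_(s <- y) s).
    by apply: commute_word yS => t; apply: commute_central_prod.
  have cz : commute (central_prod m x ^+ m) (delta y).
    apply/commute_sym/commuteX/commute_sym/commuteM; first exact/commuteX.
    exact/commuteV/commute_central_prods.
  rewrite [LHS]/delta py zy expgMn // invgM mulgA -[_ * _ / central_prod m y]mulgA.
  by rewrite -/(delta y) cz mulgK.
have central_prod_wv : central_prod m w = central_prod m v * (g ^+ m) ^+ n.
  rewrite (central_prod_perm m_central permwv wS) central_prod_cat.
  have -> : central_prod m (nseq n g) = (g ^+ m) ^+ n.
    elim: n {n0 permwv} => [|k IH]; first by rewrite /central_prod big_nil.
    by rewrite expgS -IH -central_prod_cons.
  exact/commute_sym/commuteX/commuteX/commute_central_prod.
have delta_wv k : (delta (iter_word k w))^-1 * delta (iter_word k v) = g ^+ (m * n * k).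
  rewrite /delta !prod_iter_word !central_prod_iter pwv central_prod_wv.
  rewrite expgMn; last first.
    exact/commuteX/commuteX/commute_central_prod.
  rewrite invgM invgK mulgA mulgVK.
  rewrite -!expgnA mulnA; apply: (canLR (mulgK _)).
  exact: commuteX2 (commute_central_prod m_central vS gS).
have [|i [j [ij e]]] := @pigeonhole _ [seq x^-1 * y | x <- F, y <- F]
    (fun k => g ^+ (m * n * k)).
  move=> k; rewrite -delta_wv; apply/allpairsP.
  exists (delta (iter_word k w), delta (iter_word k v)).
  by rewrite !delta_F //; apply: word_iter.
rewrite /= in e; exists (m * n * (j - i))%N; first by rewrite !muln_gt0 m0 n0 subn_gt0.
by rewrite mulnBr expgnFr ?e ?mulgV // leq_mul // ltnW.
Qed.

(** * A degree that detects an element of infinite order *)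

Definition letter_counts w : 'rV[rat]_(size S) :=
  (\row_i (count_mem (nth 1%g S i) w)%:R)%R.

Lemma letter_counts_cat w v :
  letter_counts (w ++ v) = (letter_counts w + letter_counts v)%R.
Proof. by apply/rowP => i; rewrite !mxE count_cat natrD. Qed.

Lemma letter_counts_iter k w : letter_counts (iter_word k w) = (letter_counts w *+ k)%R.
Proof.
elim: k => [|k IH]; first by apply/rowP => i; rewrite !mxE.
by rewrite letter_counts_cat IH mulrS.
Qed.

Lemma letter_counts_inj w v : word w -> word v ->
  letter_counts w = letter_counts v -> perm_eq w v.
Proof.
move=> wS vS /rowP e; apply/allP => s.
rewrite mem_cat => sw; have sS : s \in S by case/orP: sw => [/wS|/vS].
have := e (Ordinal (etrans (index_mem s S) sS)); rewrite !mxE nth_index //.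
by move=> /eqP; rewrite eqr_nat.
Qed.

(** The rational span of the differences of letter counts of words with equal
    products; the denominator n makes it a subspace over rat. *)
Definition relation_vector (x : 'rV[rat]_(size S)) := exists w v n,
  [/\ word w, word v, (0 < n)%N, \prod_(s <- w) s = \prod_(s <- v) s
    & (x *+ n = letter_counts w - letter_counts v)%R].

(** Sums and multiples of relations come from concatenating and iterating the
    words; a negative multiple exchanges the two words. *)
Lemma relation_vector_subspace :
  [/\ relation_vector 0%R,
      forall x y, relation_vector x -> relation_vector y ->
        relation_vector (x + y)%R
    & forall a x, relation_vector x -> relation_vector (a *: x)%R].
Proof.
split.
- by exists [::], [::], 1%N; split; rewrite // subrr.
- move=> x y [w [v [n [wS vS n0 wv xn]]]] [w' [v' [n' [wS' vS' n0' wv' yn]]]].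
  exists (iter_word n' w ++ iter_word n w'), (iter_word n' v ++ iter_word n v').
  exists (n * n')%N.
  split; rewrite ?muln_gt0 ?n0 //; try by apply/word_cat; split; apply: word_iter.
    by rewrite !big_cat /= !prod_iter_word wv wv'.
  rewrite !letter_counts_cat !letter_counts_iter mulrnDl mulrnA xn mulnC mulrnA yn.
  by rewrite !mulrnBl addrACA opprD.
move=> a x [w [v [n [wS vS n0 wv xn]]]].
have denE : (denq a)%:~R = `|denq a|%N%:R :> rat by rewrite pmulrn absz_denq.
have xa : ((a *: x) *+ (n * `|denq a|) = (x *+ n) *~ numq a)%R.
  rewrite -scaler_nat natrM scalerA -denE mulrAC -mulrA -numqE.
  by rewrite -scaler_int -scaler_nat scalerA mulrC.
have n0' : (0 < n * `|denq a|)%N by rewrite muln_gt0 n0 absz_gt0 denq_neq0.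
case: (numq a) xa => p xa.
  exists (iter_word p w), (iter_word p v), (n * `|denq a|)%N; rewrite xa xn.
  split=> //; try exact: word_iter; first by rewrite !prod_iter_word wv.
  by rewrite !letter_counts_iter -mulrnBl.
exists (iter_word p.+1 v), (iter_word p.+1 w), (n * `|denq a|)%N; rewrite xa xn.
split=> //; try exact: word_iter; first by rewrite !prod_iter_word wv.
by rewrite !letter_counts_iter -mulrnBl NegzE mulrNz -mulNrz opprB.
Qed.

(** A functional that kills all relations and not g assigns a rational value to
    every word, depending only on its product. Multiplying it by its value at g
    makes that value a square, hence positive, and a common denominator makes
    all values integers. *)
Lemma partial_degree g : g \in S -> (forall k, (0 < k)%N -> g ^+ k <> 1) ->
  exists2 c : G -> int,
    forall w, word w -> c (\prod_(s <- w) s) = (\sum_(s <- w) c s)%R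
    & (0 < c g)%R.
Proof.
move=> gS ginf; have [L0 LD LZ] := relation_vector_subspace.
have gL : ~ relation_vector (letter_counts [:: g]).
  case=> w [v [n [wS vS n0 wv e]]].
  have [|k k0 /(ginf k k0)//] := relation_torsion wS vS gS n0 wv.
  apply: letter_counts_inj => //; first by apply/word_cat; split=> //; apply: word_nseq.
  rewrite letter_counts_cat -[letter_counts w](subrK (letter_counts v)) -e.
  congr (_ + _)%R; rewrite -letter_counts_iter; congr letter_counts.
  by rewrite /iter_word; elim: n {n0 e} => //= n ->.
have [c0 cL cg] := separating_functional L0 LD LZ gL.
pose lambda := ((letter_counts [:: g] *m c0) 0 0)%R.
have lambda0 : (lambda != 0)%R.
  by apply: contra cg => /eqP l0; apply/eqP/matrixP => i j; rewrite !ord1 [LHS]l0 mxE.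
pose val w := (lambda * (letter_counts w *m c0) 0 0)%R.
have val_cat w v : (val (w ++ v) = val w + val v)%R.
  by rewrite /val letter_counts_cat mulmxDl mxE mulrDr.
have val_nil : val [::] = 0%R.
  have /(congr1 (fun x => x - val [::])%R) := val_cat [::] [::].
  by rewrite addrK subrr.
have [s m k [p]|s sS|d d0 dP] :=
  @common_multiple _ S (fun s m => exists p : int, (val [:: s] *+ m = p%:~R)%R).
- by move=> e; exists (p *+ k)%R; rewrite mulrnA e rmorphMn.
- exists `|denq (val [:: s])|%N; first by rewrite absz_gt0 denq_neq0.
  by exists (numq (val [:: s])); rewrite numqE -mulr_natr -[in RHS]absz_denq.
have val_int w : word w -> exists p : int, (val w *+ d = p%:~R)%R.
  elim: w => [|s w IH]; first by exists 0%R; rewrite val_nil mul0rn.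
  case/word_cons => /dP[p e] /IH[q e']; exists (p + q)%R.
  by rewrite -cat1s val_cat mulrnDl e e' intrD.
(* The default value 0 is only taken at elements that are not products of
   letters. *)
pose c h := xget 0%R [set p : int | exists w,
  [/\ word w, \prod_(s <- w) s = h & (val w *+ d = p%:~R)%R]].
have cE w : word w -> ((c (\prod_(s <- w) s)%g)%:~R = val w *+ d)%R.
  move=> wS; rewrite /c; case: xgetP => [p _ [v [vS vw <-]]|].
    congr (_ *+ _)%R; rewrite /val; congr (_ * fun_of_matrix _ 0 0)%R.
    apply: subr0_eq; rewrite -mulmxBl; apply: cL.
    by exists v, w, 1%N; split.
  by have [p e] := val_int w wS => /(_ p); case; exists w.
have c1 s : s \in S -> ((c s)%:~R = val [:: s] *+ d)%R.
  by move=> sS; rewrite -cE ?big_seq1 //; apply/word_cons.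
exists c => [w wS|].
  apply: (@intr_inj rat); rewrite cE // rmorph_sum /=.
  elim: w wS => [|s w IH] => [_|/word_cons[sS wS]].
    by rewrite val_nil mul0rn big_nil.
  by rewrite -cat1s val_cat mulrnDl big_cons c1 // IH.
by rewrite -(ltr0z rat) c1 // pmulrn_lgt0 // /val -expr2 exprn_even_gt0.
Qed.

End Words.

(** * Rings without unit *)

Section RngTheory.
Variable R : rngType.
Implicit Types x y f : R.

Lemma rng_mul0l x : 0%R * x = 0%R.
Proof. by apply: (@addrI R (0%R * x)); rewrite -rng_mulDl !addr0. Qed.

Lemma rng_mul0r x : x * 0%R = 0%R.
Proof. by apply: (@addrI R (x * 0%R)); rewrite -rng_mulDr !addr0. Qed.

Lemma rng_suml (I : Type) (s : seq I) (P : pred I) (F : I -> R) y :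
  (\sum_(i <- s | P i) F i)%R * y = (\sum_(i <- s | P i) (F i * y)%g)%R.
Proof.
exact: (big_morph (fun x => x * y) (fun a b => rng_mulDl a b y) (rng_mul0l y)).
Qed.

Lemma rng_sumr (I : Type) (s : seq I) (P : pred I) (F : I -> R) x :
  x * (\sum_(i <- s | P i) F i)%R = (\sum_(i <- s | P i) (x * F i)%g)%R.
Proof.
exact: (big_morph (fun y => x * y) (fun a b => rng_mulDr x a b) (rng_mul0r x)).
Qed.

Lemma rng_mulrnl x y n : (x *+ n)%R * y = ((x * y)%g *+ n)%R.
Proof. by elim: n => [|n IH]; rewrite ?rng_mul0l // !mulrS rng_mulDl IH. Qed.

Lemma rng_mulrnr x y n : x * (y *+ n)%R = ((x * y)%g *+ n)%R.
Proof. by elim: n => [|n IH]; rewrite ?rng_mul0r // !mulrS rng_mulDr IH. Qed.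

(** In generating functions, P^2 = (1 + u)^K P with constant term f, so that
    P = (1 + u)^K f. At rank n the recursion reads
    2 f p_n = p_n + C(K, n) f after cancelling the middle terms; multiplying it
    by f gives f p_n = C(K, n) f, and then p_n itself. *)
Lemma idempotent_binomials f (K : nat) (p : nat -> R) :
    f * f = f -> (forall n, f * p n = p n * f) -> p 0%N = f ->
    (forall n, \sum_(i < n.+1) (p i * p (n - i)%N)%g =
               \sum_(i < n.+1) p (n - i)%N *+ 'C(K, i))%R ->
  forall n, p n = (f *+ 'C(K, n))%R.
Proof.
move=> ff fp p0 conv; elim/ltn_ind => -[_|n IH]; first by rewrite bin0 p0.
have := conv n.+1.
rewrite big_ord_recl [RHS]big_ord_recl !big_ord_recr /= !subn0 /bump /=.
rewrite !add1n subnn p0 bin0.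
under eq_bigr => i _ do
  rewrite add1n subSS !IH ?ltnS ?leq_subr // rng_mulrnl rng_mulrnr ff -mulrnA.
under [in RHS]eq_bigr => i _ do rewrite add1n subSS !IH ?ltnS ?leq_subr // -mulrnA.
set mid := (\sum_(i < n) _)%R; set q := p n.+1; set b := 'C(K, n.+1).
rewrite mulr1n [LHS]addrCA [RHS]addrCA => /(@addrI _ _ _ _); rewrite -fp -/q => e.
have fq : f * q = (f *+ b)%R.
  apply: (@addrI R (f * q)); have /(congr1 (fun x => f * x)) := e.
  by rewrite !rng_mulDr !mulgA ff rng_mulrnr ff => ->.
by apply: (@addIr R (f *+ b)%R); rewrite -e fq.
Qed.

End RngTheory.

(** * Components in a graded ring *)

Section GradedTheory.
Variables (G : groupType) (R : rngType) (R_ : G -> set R).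
Hypothesis gradedR : graded R_.
Implicit Types (x y r f : R) (g h : G) (c : G -> R) (s : seq G).

Lemma decomposition_sum r c s : decomposition R_ r c -> uniq s ->
  (forall g, g \notin s -> c g = 0%R) -> r = (\sum_(g <- s) c g)%R.
Proof.
case=> _ _ -> us cs; rewrite (fsbigE s) //; last by move=> g _; apply: cs.
by apply: eq_bigl => g; rewrite in_setT.
Qed.

Lemma sum_decomposition r c s : (forall g, R_ g (c g)) -> uniq s ->
    (forall g, g \notin s -> c g = 0%R) -> r = (\sum_(g <- s) c g)%R ->
  decomposition R_ r c.
Proof.
move=> Rc us cs ->; split=> //.
  apply: (@sub_finite_set _ _ [set` s]); last exact: finite_seq.
  by move=> g /=; apply: contra_neqT => /cs.
rewrite (fsbigE s) //; last by move=> g _; apply: cs.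
by apply: eq_bigl => g; rewrite in_setT.
Qed.

Lemma decomposition_component r c : decomposition R_ r c -> component R_ r = c.
Proof.
case: gradedR => _ dsum _ rc; have [d [_ dmin]] := dsum r.
by rewrite -(dmin _ rc) -(dmin _ (componentP r gradedR)).
Qed.

Lemma homogeneous_component r g : R_ g (component R_ r g).
Proof. by case: (componentP r gradedR). Qed.

Lemma homogeneous0 g : R_ g 0%R.
Proof. by case: gradedR => /(_ g)[]. Qed.

Lemma homogeneousD g x y : R_ g x -> R_ g y -> R_ g (x + y)%R.
Proof.
case: gradedR => /(_ g)[R0 RB] _ _ Rx Ry.
by rewrite -[y]opprK; apply: (RB) => //; rewrite -sub0r; apply: RB.
Qed.

Lemma homogeneousM g h x y : R_ g x -> R_ h y -> R_ (g * h) (x * y).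
Proof. by case: gradedR => _ _; apply. Qed.

Lemma support_seq r : exists s, [/\ uniq s,
  forall g, (g \in s) = (component R_ r g != 0%R)
  & r = (\sum_(g <- s) component R_ r g)%R].
Proof.
have [_ finr _] := componentP r gradedR.
have /finite_seqP[s sE] := finr.
have memE g : (g \in undup s) = (component R_ r g != 0%R).
  rewrite mem_undup; have /predeqP/(_ g)/= [to_s from_s] := sE.
  exact/idP/idP.
exists (undup s); split=> //; first exact: undup_uniq.
apply: (decomposition_sum (componentP r gradedR)); first exact: undup_uniq.
by move=> g; rewrite memE negbK => /eqP.
Qed.

Lemma component_homogeneous g x h : R_ g x ->
  component R_ x h = (if h == g then x else 0%R).
Proof.
move=> gx; rewrite (@decomposition_component x (fun h => if h == g then x else 0%R)) //.
apply: (@sum_decomposition _ _ [:: g]) => // [k|k|].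
- by case: eqP => [->|_]; last exact: homogeneous0.
- by rewrite inE => /negPf->.
- by rewrite big_seq1 eqxx.
Qed.

Lemma componentD x y g :
  component R_ (x + y)%R g = (component R_ x g + component R_ y g)%R.
Proof.
have [s [us sE _]] := support_seq x; have [t [ut tE _]] := support_seq y.
rewrite (@decomposition_component _
  (fun h => component R_ x h + component R_ y h)%R) //.
have stE h : h \notin undup (s ++ t) ->
    component R_ x h = 0%R /\ component R_ y h = 0%R.
  by rewrite mem_undup mem_cat negb_or sE tE !negbK => /andP[/eqP-> /eqP->].
apply: (@sum_decomposition _ _ (undup (s ++ t))); rewrite ?undup_uniq //.
- by move=> h; apply: homogeneousD; apply: homogeneous_component.
- by move=> h /stE[-> ->]; rewrite addr0.
- by rewrite big_split /=; congr (_ + _)%R;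
    apply: decomposition_sum (componentP _ gradedR) (undup_uniq _) _ => h /stE[].
Qed.

Lemma component_sum (I : Type) (s : seq I) (F : I -> R) g :
  component R_ (\sum_(i <- s) F i)%R g = (\sum_(i <- s) component R_ (F i) g)%R.
Proof.
apply: (big_morph (fun x => component R_ x g)); first by move=> x y; apply: componentD.
by rewrite (@component_homogeneous g) ?if_same //; apply: homogeneous0.
Qed.

Lemma component_mulr x y g h : R_ g y ->
  component R_ (x * y) (h * g) = component R_ x h * y.
Proof.
move=> gy; have [s [us sE {1}->]] := support_seq x.
rewrite rng_suml component_sum.
under eq_bigr => k _ do
  rewrite (component_homogeneous _ (homogeneousM (homogeneous_component x k) gy))
          (inj_eq (mulIg g)) eq_sym.
rewrite -big_mkcond /=; case: (boolP (h \in s)) => hs; last first.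
  rewrite big1_seq => [|k /andP[/eqP-> ks]]; last by rewrite ks in hs.
  by move: hs; rewrite sE negbK => /eqP->; rewrite rng_mul0l.
by rewrite -big_filter filter_pred1_uniq // big_seq1.
Qed.

Lemma component_mull x y g h : R_ g x ->
  component R_ (x * y) (g * h) = x * component R_ y h.
Proof.
move=> gx; have [s [us sE {1}->]] := support_seq y.
rewrite rng_sumr component_sum.
under eq_bigr => k _ do
  rewrite (component_homogeneous _ (homogeneousM gx (homogeneous_component y k)))
          (inj_eq (mulgI g)) eq_sym.
rewrite -big_mkcond /=; case: (boolP (h \in s)) => hs; last first.
  rewrite big1_seq => [|k /andP[/eqP-> ks]]; last by rewrite ks in hs.
  by move: hs; rewrite sE negbK => /eqP->; rewrite rng_mul0r.
by rewrite -big_filter filter_pred1_uniq // big_seq1.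
Qed.

(** The component f_h is annihilated by R_g on the right if f_(h^g) = 0, hence
    by R_e = R_g R_(g^-1); but f_h = f_h u_e for some u. *)
Lemma support_conj f h g :
    (forall g h, prod_set (R_ g) (R_ h) = R_ (g * h)) -> s_unital R ->
    (forall r, f * r = r * f) -> component R_ f h != 0%R ->
  component R_ f (h ^ g) != 0%R.
Proof.
move=> strong sunit fC; apply: contra_neq => fhg.
have ann r : R_ g r -> component R_ f h * r = 0%R.
  move=> gr; rewrite -(component_mulr f h gr) fC conjgC.
  by rewrite (component_mull _ _ gr) fhg rng_mul0r.
have [[u fu] _] := sunit (component R_ f h).
have := component_mull u 1 (homogeneous_component f h).
rewrite -fu (component_homogeneous _ (homogeneous_component f h)) mulg1 eqxx => ->.
have : R_ (g * g^-1) (component R_ u 1) by rewrite mulgV; apply: homogeneous_component.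
rewrite -strong => -[s sR ->]; rewrite rng_sumr big_seq big1 // => p /sR[gp _].
by rewrite mulgA ann // rng_mul0l.
Qed.

(** The operator [E n] multiplies the h-component by 'C(e h, n), where e is c
    shifted by 2 K and d is c shifted by K, so that e (h * k) = d h + d k. Applied to
    f * f and to f, it turns f * f = f into the recursion of
    [idempotent_binomials], both sides being expanded by the Vandermonde
    identity. The derivation given by n = 1 alone would only show that c g
    annihilates f_g, which is not enough if R has additive torsion. *)
Lemma central_idempotent_degree f (c : G -> int) g :
    central_idempotent f ->
    (forall h k, component R_ f h != 0%R -> component R_ f k != 0%R ->
       c (h * k) = (c h + c k)%R) ->
  component R_ f g != 0%R -> (c g <= 0)%R.
Proof.
move=> [ff fC] cM fg; rewrite leNgt; apply/negP => cg.
have [s [us sE fE]] := support_seq f.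
(* Any bound on the absolute values of the degrees would do. *)
pose K := (\sum_(h <- s) absz (c h))%N.
pose d h := absz (c h + K%:Z)%R.
have dE h : h \in s -> ((d h)%:Z = c h + K%:Z)%R.
  move=> hs; rewrite gez0_abs // -lerBlDr sub0r.
  by apply: lerNnormlW; rewrite -abszE lez_nat /K (big_rem h) //= leq_addr.
pose e h := absz (c h + K%:Z + K%:Z)%R.
have eE h : h \in s -> e h = (K + d h)%N.
  by move=> hs; rewrite /e -dE // addnC.
have eM h k : h \in s -> k \in s -> e (h * k) = (d h + d k)%N.
  move=> hs ks; rewrite /e cM -?sE //.
  have -> : (c h + c k + K%:Z + K%:Z = (d h)%:Z + (d k)%:Z)%R.
    by rewrite !dE // addrACA addrA.
  by [].
pose p n := (\sum_(h <- s) component R_ f h *+ 'C(d h, n))%R.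
have p0 : p 0%N = f by rewrite [RHS]fE; apply: eq_bigr => h _; rewrite bin0.
pose T := s ++ [seq h * k | h <- s, k <- s].
pose E n x := (\sum_(h <- undup T) component R_ x h *+ 'C(e h, n))%R.
have E_sum n (I : Type) (r : seq I) (F : I -> R) :
    (E n (\sum_(i <- r) F i) = \sum_(i <- r) E n (F i))%R.
  rewrite exchange_big /=; apply: eq_bigr => h _.
  by rewrite component_sum -sumrMnl.
have E_hom n x h : R_ h x -> h \in T -> E n x = (x *+ 'C(e h, n))%R.
  move=> hx hT; rewrite /E (bigD1_seq h) ?mem_undup ?undup_uniq //=.
  rewrite (component_homogeneous _ hx) eqxx big1 ?addr0 // => k kh.
  by rewrite (component_homogeneous _ hx) (negPf kh) mul0rn.
(* Both sides equal [E n f]. *)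
have conv n : (\sum_(i < n.+1) (p i * p (n - i)%N)%g =
               \sum_(i < n.+1) p (n - i)%N *+ 'C(K, i))%R.
  transitivity (E n (f * f)).
    rewrite [in RHS]fE rng_suml E_sum.
    under [LHS]eq_bigr => i _ do rewrite rng_suml.
    rewrite exchange_big /=; apply: eq_big_seq => h hs.
    rewrite rng_sumr E_sum.
    under [LHS]eq_bigr => i _ do rewrite rng_sumr.
    rewrite exchange_big /=; apply: eq_big_seq => k ks.
    rewrite (E_hom _ _ (h * k)); first last.
    - by rewrite mem_cat allpairs_f ?orbT.
    - by apply: homogeneousM; apply: homogeneous_component.
    rewrite eM // -binomial.Vandermonde -sumrMnr; apply: eq_bigr => i _.
    by rewrite rng_mulrnl rng_mulrnr -mulrnA mulnC.
  rewrite ff {1}fE E_sum.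
  under [RHS]eq_bigr => i _ do rewrite -sumrMnl.
  rewrite [RHS]exchange_big /=; apply: eq_big_seq => h hs.
  rewrite (E_hom _ _ h) ?mem_cat ?hs //; last exact: homogeneous_component.
  rewrite eE // -binomial.Vandermonde -sumrMnr; apply: eq_bigr => i _.
  by rewrite -mulrnA mulnC.
have := idempotent_binomials ff (fun n => fC (p n)) p0 conv (d g).
have gs : g \in s by rewrite sE.
have Kd : (K < d g)%N by rewrite -ltz_nat dE // ltrDr.
rewrite (bin_small Kd) mulr0n => /(congr1 (fun x => component R_ x g)).
rewrite component_sum (component_homogeneous _ (homogeneous0 g)) if_same.
have homMn h n : R_ h (component R_ f h *+ n)%R.
  elim: n => [|n IH]; first exact: homogeneous0.
  by rewrite mulrS; apply: homogeneousD IH; apply: homogeneous_component.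
rewrite (bigD1_seq g) //= big1 => [|h hg].
  rewrite addr0 (component_homogeneous _ (homMn g _)) eqxx binn => /eqP.
  exact/negP.
by rewrite (component_homogeneous _ (homMn h _)) eq_sym (negPf hg).
Qed.

End GradedTheory.

(** * Supports of central idempotents *)

(** An element of infinite order would have a positive degree for the degree of
    [partial_degree], against [central_idempotent_degree]. *)
Lemma support_torsion (G : groupType) (R : rngType) (R_ : G -> set R) (f : R) g :
    strongly_graded R_ -> s_unital R -> central_idempotent f ->
  component R_ f g != 0%R -> exists2 k, (0 < k)%N & g ^+ k = 1.
Proof.
move=> [gradedR strong] sunit fci fg.
have [s [_ sE _]] := support_seq gradedR f.
have Sconj : {in s &, forall h k, h ^ k \in s}.
  move=> h k hs _; rewrite sE; apply: support_conj => //; last by rewrite -sE.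
  exact: fci.2.
have gs : g \in s by rewrite sE.
have [//|ginf] := pselect (exists2 k, (0 < k)%N & g ^+ k = 1).
have [k k0 gk|c cM] := partial_degree Sconj gs; first by apply: ginf; exists k.
rewrite ltNge => /negP[]; apply: (central_idempotent_degree gradedR fci) fg.
move=> h k; rewrite -!sE => hs ks.
have := cM [:: h; k]; rewrite !big_cons !big_nil mulg1 addr0; apply.
by move=> t; rewrite !inE => /orP[]/eqP->.
Qed.

Theorem corollary2p1 (G : groupType) (R : rngType) (R_ : G -> set R)
  (sgR : strongly_graded R_) (suR : s_unital R) :
  (forall f : R, f <> 0%R -> central_idempotent f ->
     finite_set (support_group R_ f)) /\
  (torsion_free G ->
     forall f : R, central_idempotent f -> R_ 1%g f).
Proof.
have [gradedR strong] := sgR.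
split=> [f _ fci|Gtf f fci]; have [s [_ sE fE]] := support_seq gradedR f.
  have -> : support_group R_ f = subgroup_generated [set` s].
    by congr subgroup_generated; apply/seteqP; split=> g /=; rewrite sE.
  apply: finite_subgroup_generated => [h k hs _|g gs].
    rewrite sE; apply: support_conj => //; last by rewrite -sE.
    exact: fci.2.
  by apply: support_torsion sgR suR fci _; rewrite -sE.
rewrite fE big_seq; apply: big_ind => [|x y|g gs].
- exact: homogeneous0.
- exact: homogeneousD.
- rewrite sE in gs; have [k k0 /(Gtf g k k0) g1] := support_torsion sgR suR fci gs.
  by rewrite -{1}g1; apply: homogeneous_component.
Qed.
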